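(* Let $R$ be a ring, let $M$ be a left $R$-module and let $N$ be a nontrivial submodule of $M$. The following conditions are equivalent: (1) $G(M)$ is infinite and $\deg(N)<\infty$; (2) the following conditions hold: (i) $N$ contains a unique simple submodule $S$; (ii) $\mathrm{End}(S)$ is infinite; (iii) $G(M/S)$ is finite or, equivalently, $\deg(S)<\infty$; (iv) there exist submodules $B\subseteq A\subseteq M$ such that $N\cap A=0$ and $A/B\simeq S$.
   Context: Rings are associative with unity and modules are unitary left modules. A nontrivial submodule of $M$ is a submodule different from $0$ and $M$. The intersection graph $G(M)$ is the simple graph whose vertices are the nontrivial submodules of $M$, two distinct vertices being adjacent iff their intersection is nonzero; $G(M)$ is called finite or infinite according to whether its vertex set is. For a nontrivial submodule $N$ of $M$, $\deg(N)$ is the cardinality of the set of all nontrivial submodules $K\neq N$ of $M$ with $N\cap K\neq 0$ (the degree of $N$ in $G(M)$). $\mathrm{End}(S)$ is the ring of $R$-endomorphisms of $S$. *)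

(* Defs.v *)
From HB Require Import structures.
From mathcomp Require Import all_boot all_order all_algebra.
From mathcomp Require Import generic_quotient ring_quotient.
From mathcomp Require Import boolp classical_sets cardinality.

Set Implicit Arguments.
Unset Strict Implicit.
Unset Printing Implicit Defensive.

Import GRing.Theory.
Local Open Scope ring_scope.
Local Open Scope quotient_scope.
Local Open Scope classical_set_scope.

(* The submodules of [M] are the elements of the MathComp type [submodClosed M]
   of bundled boolean predicates.  Under the axioms of [boolp] every subset is
   decidable, and equality of bundles is equality of subsets ([submod_ext]). *)

Section Submodules.
Variables (R : pzRingType) (M : lmodType R).
Implicit Types S T N K : submodClosed M.

Lemma submod_ext S T : S =i T -> S = T.
Proof.
case: S T => s [[s1] [s2]] [t [[t1] [t2]]] eqST.
have est : s = t by apply/funext => x; apply: eqST.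
case: _ / est t1 t2 {eqST} => t1 t2.
by rewrite (Prop_irrelevance s1 t1) (Prop_irrelevance s2 t2).
Qed.

Definition mk_submod (P : pred M) (closedP : submod_closed P) :
    submodClosed M :=
  HB.pack P (GRing.isSubmodClosed.Build R M P closedP).

Fact zero_submod_closed : submod_closed (pred1 (0 : M)).
Proof.
split=> [|a x y /eqP-> /eqP->]; first exact: eqxx.
by rewrite scaler0 addr0; apply: eqxx.
Qed.
Definition zero_submod := mk_submod zero_submod_closed.

Fact full_submod_closed : submod_closed (predT : pred M). Proof. by []. Qed.
Definition full_submod := mk_submod full_submod_closed.

Fact cap_submod_closed S T : submod_closed (predI (mem S) (mem T)).
Proof.
split=> [|a x y /andP[/= xS xT] /andP[/= yS yT]].
  by apply/andP; split; apply: rpred0.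
by apply/andP; split=> /=; apply: rpredD => //; apply: rpredZ.
Qed.
Definition cap_submod S T := mk_submod (cap_submod_closed S T).

Definition nontrivial N := N <> zero_submod /\ N <> full_submod.

Definition simple_submod S :=
  S <> zero_submod /\
  forall T, {subset T <= S} -> T = zero_submod \/ T = S.

Definition adjacent N K := N <> K /\ cap_submod N K <> zero_submod.

Definition neighbors N : set (submodClosed M) :=
  [set K | nontrivial K /\ adjacent N K].

Definition submod_type S : Type := {x : M | x \in S}.

End Submodules.

Definition vertices (R : pzRingType) (M : lmodType R) : set (submodClosed M) :=
  [set K | nontrivial K].
Arguments vertices {R} M _.

Section SubmoduleType.
Variables (R : pzRingType) (M : lmodType R) (S : submodClosed M).

HB.instance Definition _ := SubChoice.on (submod_type S).
Fact submod_type_closed : submod_closed (fun x : M => x \in S).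
Proof.
split=> [|a x y xS yS]; first exact: rpred0.
by apply: (@rpredD _ S) => //; apply: rpredZ.
Qed.
HB.instance Definition _ :=
  GRing.SubChoice_isSubLmodule.Build R M (fun x : M => x \in S) (submod_type S)
    submod_type_closed.

Definition End := {linear submod_type S -> submod_type S}.

End SubmoduleType.

Section QuotientModule.
Variables (R : pzRingType) (M : lmodType R) (S : submodClosed M).

Fact submod_zmod_closed : zmod_closed (fun x : M => x \in S).
Proof.
split=> [|x y xS yS]; first exact: rpred0.
by rewrite -scaleN1r; apply: (@rpredD _ S) => //; apply: rpredZ.
Qed.

Definition submod_zmod : zmodClosed M :=
  HB.pack (fun x : M => x \in S)
    (GRing.isZmodClosed.Build M (fun x : M => x \in S) submod_zmod_closed).

Definition quot_mod : Type := Quotient.quot submod_zmod.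
HB.instance Definition _ := GRing.Zmodule.on quot_mod.
HB.instance Definition _ := EqQuotient.on quot_mod.

Definition quot_scale (a : R) (x : quot_mod) : quot_mod :=
  \pi_quot_mod (a *: repr x).

Lemma eq_quot_mod (x y : M) :
  (x == y %[mod quot_mod]) = (x - y \in S).
Proof. by rewrite -Quotient.idealrBE. Qed.

Lemma pi_quot_scale a x : quot_scale a (\pi_quot_mod x) = \pi_quot_mod (a *: x).
Proof.
apply/eqP; rewrite eq_quot_mod -scalerBr; apply: rpredZ.
by rewrite -eq_quot_mod reprK.
Qed.

Lemma pi_quot_modD x y :
  \pi_quot_mod (x + y) = \pi_quot_mod x + \pi_quot_mod y.
Proof. exact: (@pi_addr _ _ _ _ _ (Quotient.quot submod_zmod)). Qed.

Fact quot_scaleA a b x : quot_scale a (quot_scale b x) = quot_scale (a * b) x.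
Proof.
by elim/quotW: x => x; rewrite (pi_quot_scale b x) !pi_quot_scale scalerA.
Qed.
Fact quot_scale1 : left_id 1 quot_scale.
Proof. by elim/quotW=> x; rewrite pi_quot_scale scale1r. Qed.
Fact quot_scaleDr : right_distributive quot_scale +%R.
Proof.
move=> a; elim/quotW=> x; elim/quotW=> y; rewrite -pi_quot_modD !pi_quot_scale.
by rewrite scalerDr pi_quot_modD.
Qed.
Fact quot_scaleDl x : {morph quot_scale^~ x : a b / a + b}.
Proof.
by elim/quotW: x => x a b; rewrite !pi_quot_scale scalerDl pi_quot_modD.
Qed.
HB.instance Definition _ := GRing.Zmodule_isLmodule.Build R quot_mod
  quot_scaleA quot_scale1 quot_scaleDr quot_scaleDl.

End QuotientModule.

Section Subquotient.
Variables (R : pzRingType) (M : lmodType R) (A B : submodClosed M).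

Fact trace_submod_closed :
  submod_closed (fun x : submod_type A => val x \in B).
Proof.
split=> [|a x y xB yB]; first exact: (@rpred0 _ B).
by apply: (@rpredD _ B) => //; apply: rpredZ.
Qed.

(* the submodule of the module [A] with underlying set [A :&: B], which is [B]
   when [B] is contained in [A] *)
Definition trace_submod : submodClosed (submod_type A) :=
  mk_submod trace_submod_closed.

Definition subquotient : lmodType R := quot_mod trace_submod.

End Subquotient.

Definition isomorphic (R : pzRingType) (U V : lmodType R) :=
  exists f : {linear U -> V}, bijective f.

Definition unique_simple_in (R : pzRingType) (M : lmodType R)
    (N S : submodClosed M) :=
  unique (fun T : submodClosed M => simple_submod T /\ {subset T <= N}) S.

(* Main.v *)
(* If [deg N] is finite then only finitely many submodules meet [N], so each
   map [K |-> K + T], with [0 <> T <= N], has finite range.  Two distinct simple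
   [S, S' <= N] would make [K = (K + S) :&: (K + S')] for the infinitely many [K]
   that meet [N] in [0], which is absurd.  Applying the pigeonhole principle to
   [K |-> K + S] and then, for a fixed such [A], to [K |-> (K :&: A) + S] yields
   infinitely many complements [K] of [S] in [A + S] with the same [B = K :&: A].
   They are the graphs of maps [A -> S] with kernel [B], that is, of the
   composites of [A -> A/B ~ S] with endomorphisms of [S].  Conversely, distinct
   endomorphisms of [S] give distinct graphs; and when finitely many submodules
   contain [S], a nonzero [T <= N] avoiding [S] would have finitely many
   submodules (each recovered from its sum with [S]), hence a simple one
   different from [S]. *)
From HB Require Import structures.
Require Import Defs.
From mathcomp Require Import all_boot all_order all_algebra finmap.
From mathcomp Require Import generic_quotient.
From mathcomp Require Import boolp classical_sets cardinality.

Set Implicit Arguments.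
Unset Strict Implicit.
Unset Printing Implicit Defensive.

Import GRing.Theory.
Local Open Scope ring_scope.
Local Open Scope quotient_scope.
Local Open Scope classical_set_scope.

(** * Pigeonhole principle for infinite sets *)

Section FiniteSets.
Context {T U : Type}.
Implicit Types (X : set T) (f : T -> U).

(** Otherwise [X] would be a finite union of finite fibres. *)
Lemma infinite_fibre X f (Y : set U) :
  infinite_set X -> (forall x, X x -> Y (f x)) -> finite_set Y ->
  exists y, infinite_set [set x | X x /\ f x = y].
Proof.
move=> infX XY finY; apply: contrapT => /forallNP fibfin; apply: infX.
apply: (@sub_finite_set _ _ (\bigcup_(y in Y) [set x | X x /\ f x = y])).
  by move=> x Xx; exists (f x) => //; apply: XY.
by apply: bigcup_finite => // y _; apply: contrapT => /fibfin.
Qed.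

Lemma finite_set_inj X f (Y : set U) :
  (forall x, X x -> Y (f x)) ->
  (forall x y, X x -> X y -> f x = f y -> x = y) ->
  finite_set Y -> finite_set X.
Proof.
move=> XY injf finY; apply: contrapT => infX.
have [y infy] := infinite_fibre infX XY finY.
have [x [Xx fx]] := infinite_setN0 infy.
apply: infy; apply: sub_finite_set (finite_set1 x) => z [Xz fz] /=.
by apply: injf => //; rewrite fz fx.
Qed.

End FiniteSets.

(** * Sums, intersections and counting of submodules *)

Section SubmoduleLattice.
Context {R : pzRingType} {M : lmodType R}.
Implicit Types S T N K A B C : submodClosed M.

Lemma submodB S x y : x \in S -> y \in S -> x - y \in S.
Proof. by have [_] := submod_zmod_closed S; apply. Qed.

Lemma in_cap_submod S T x : (x \in cap_submod S T) = (x \in S) && (x \in T).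
Proof. by []. Qed.

Lemma in_zero_submod (x : M) : (x \in zero_submod M) = (x == 0).
Proof. by []. Qed.

Lemma submod_eq S T : {subset S <= T} -> {subset T <= S} -> S = T.
Proof. by move=> ST TS; apply: submod_ext => x; apply/idP/idP; auto. Qed.

Lemma submod_eq0 S : {subset S <= zero_submod M} -> S = zero_submod M.
Proof.
move=> S0; apply: submod_eq => // x; rewrite in_zero_submod => /eqP->.
exact: rpred0.
Qed.

Lemma cap_submod0P S T :
  cap_submod S T = zero_submod M <->
  (forall x, x \in S -> x \in T -> x = 0).
Proof.
split=> [ST0 x xS xT | ST0].
  by apply/eqP; rewrite -in_zero_submod -ST0 in_cap_submod xS.
apply: submod_eq0 => x; rewrite in_cap_submod in_zero_submod => /andP[xS xT].
by apply/eqP; apply: ST0.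
Qed.

Lemma submod_sub_neq0 S T :
  {subset S <= T} -> S <> zero_submod M -> T <> zero_submod M.
Proof. by move=> ST nzS T0; apply: nzS; apply: submod_eq0; rewrite -T0. Qed.

Fact sum_submod_closed S T :
  submod_closed (fun x : M => `[< exists2 y, y \in S & x - y \in T >]).
Proof.
split=> [|a x y /asboolP[u uS xuT] /asboolP[v vS yvT]]; apply/asboolP.
  by exists 0; rewrite ?subr0 rpred0.
exists (a *: u + v); first by apply: rpredD => //; apply: rpredZ.
by rewrite opprD addrACA -scalerBr; apply: rpredD => //; apply: rpredZ.
Qed.
Definition sum_submod S T := mk_submod (sum_submod_closed S T).

Lemma in_sum_submod S T x :
  x \in sum_submod S T <-> exists2 y, y \in S & x - y \in T.
Proof. by split=> /asboolP. Qed.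

Lemma sub_sum_submodl S T : {subset S <= sum_submod S T}.
Proof. by move=> x xS; apply/in_sum_submod; exists x; rewrite ?subrr ?rpred0. Qed.

Lemma sub_sum_submodr S T : {subset T <= sum_submod S T}.
Proof. by move=> x xT; apply/in_sum_submod; exists 0; rewrite ?subr0 ?rpred0. Qed.

Lemma simple_submod_sub S T :
  simple_submod S -> cap_submod S T <> zero_submod M -> {subset S <= T}.
Proof.
case=> _ minS capN0.
have [x|//|capE x] := minS (cap_submod S T).
  by rewrite in_cap_submod => /andP[].
by rewrite -capE in_cap_submod => /andP[].
Qed.

(** A case of the modular law. It recovers [T] from its sum with [S], so adding [S] is injective on
    the submodules of [A]. *)
Lemma sum_submod_modular A S T :
  {subset T <= A} -> cap_submod S A = zero_submod M ->
  cap_submod (sum_submod T S) A = T.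
Proof.
move=> TA /cap_submod0P SA0; apply: submod_eq => x.
  rewrite in_cap_submod => /andP[/in_sum_submod[y yT xyS] xA].
  suff -> : x = y by [].
  apply/eqP; rewrite -subr_eq0; apply/eqP/SA0 => //.
  by apply: submodB => //; apply: TA.
by move=> xT; rewrite in_cap_submod TA // sub_sum_submodl.
Qed.

Definition above S : set (submodClosed M) := [set K | {subset S <= K}].
Definition below S : set (submodClosed M) := [set K | {subset K <= S}].
Definition meeting S : set (submodClosed M) :=
  [set K | cap_submod S K <> zero_submod M].

(** The two sets differ by at most [N] and [M] themselves; [meeting] is the easier one to compare by
    inclusion. *)
Lemma finite_neighborsE N :
  finite_set (neighbors N) <-> finite_set (meeting N).
Proof.
split=> fin; last by apply: sub_finite_set fin => K [_ []].
apply: (@sub_finite_set _ _ ([set N; full_submod M] `|` neighbors N)).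
  move=> K NK0.
  have [->|neqNK] := pselect (K = N); first by left; left.
  have [->|neqK1] := pselect (K = full_submod M); first by left; right.
  right; split; last by split=> // NK; apply: neqNK.
  split=> // K0; apply: NK0; apply/cap_submod0P => x _.
  by rewrite K0 in_zero_submod => /eqP.
by rewrite finite_setU; split=> //; apply: finite_set2.
Qed.

Lemma above_sub_meeting N T :
  {subset T <= N} -> T <> zero_submod M -> above T `<=` meeting N.
Proof.
move=> TN nzT K TK; apply: submod_sub_neq0 nzT => x xT.
by rewrite in_cap_submod TN //; apply: TK.
Qed.

Lemma meeting_simple S : simple_submod S -> meeting S = above S.
Proof.
move=> simS; rewrite eqEsubset; split=> K; first exact: simple_submod_sub.
by apply: above_sub_meeting => //; case: simS.
Qed.

Lemma finite_vertices :
  finite_set (vertices M) <-> finite_set [set: submodClosed M].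
Proof.
split=> fin; last exact: sub_finite_set fin.
apply: (@sub_finite_set _ _ ([set zero_submod M; full_submod M] `|` vertices M)).
  move=> K _.
  have [->|nzK] := pselect (K = zero_submod M); first by left; left.
  have [->|neqK1] := pselect (K = full_submod M); first by left; right.
  by right.
by rewrite finite_setU; split=> //; apply: finite_set2.
Qed.

(** Induction on the number of submodules of [N]: if [N] is not simple, pass to a proper nonzero
    submodule, which has fewer. *)
Lemma exists_simple_below N :
  finite_set (below N) -> N <> zero_submod M ->
  exists S, simple_submod S /\ {subset S <= N}.
Proof.
(* [{classic _}] supplies the choice structure that [fset_set] needs for counting. *)
pose down N : set {classic submodClosed M} := below N.
have [n] := ubnP (#|` fset_set (down N)|)%fset.
elim: n N => // n IHn N ltNn finN nzN.
have [simN|nsimN] := pselect (simple_submod N); first by exists N; split.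
have [T [TN nzT neqTN]] :
    exists T, [/\ {subset T <= N}, T <> zero_submod M & T <> N].
  apply: contrapT => /forallNP noT; apply: nsimN; split=> // T TN.
  apply: contrapT => /not_orP[nzT neqTN]; exact: (noT T).
have downT : down T `<=` down N by move=> K KT x /KT /TN.
have finDN : finite_set (down N) := finN.
have finDT : finite_set (down T) := sub_finite_set downT finDN.
have [|S [simS ST]] := IHn T _ finDT nzT; last by exists S; split=> // x /ST /TN.
rewrite -ltnS (leq_trans _ ltNn) // ltnS; apply: fproper_ltn_card.
rewrite fproperEneq; apply/andP; split.
  (* The inclusion is strict because [N] lies in [down N] but not in [down T]. *)
  apply/eqP => eqd; apply: neqTN; apply: submod_eq => //.
  have: down N N by [].
  by rewrite -(fset_setK finDN) -eqd fset_setK.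
by apply/fsubsetP => K; rewrite !in_fset_set // !inE => /downT.
Qed.

End SubmoduleLattice.

(** * Linear maps and factorization through a surjection *)

Section LinearMaps.
Context {R : pzRingType}.
Implicit Types U V W : lmodType R.

Lemma linear_ext U V (f g : {linear U -> V}) : f =1 g -> f = g.
Proof.
case: f g => f [[f1] [f2]] [g [[g1] [g2]]] /= /funext eqfg.
case: _ / eqfg g1 g2 => g1 g2.
by rewrite (Prop_irrelevance f1 g1) (Prop_irrelevance f2 g2).
Qed.

Lemma exists_linear U V (f : U -> V) :
  linear f -> exists g : {linear U -> V}, g =1 f.
Proof.
move=> linf.
by exists (HB.pack f (GRing.isLinear.Build R U V *:%R f linf) : {linear U -> V}).
Qed.

(** A set-theoretic section [s] of [h] need not be linear, but [g \o s] is, since [g] kills the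
    kernel of [h]. *)
Lemma factor_linear U V W (h : {linear U -> V}) (g : {linear U -> W}) :
  (forall y, exists x, h x = y) -> (forall x, h x = 0 -> g x = 0) ->
  exists k : {linear V -> W}, forall x, k (h x) = g x.
Proof.
move=> /choice[s sK] ker_hg.
have gs x : g (s (h x)) = g x.
  by apply/eqP; rewrite -subr_eq0 -linearB ker_hg // linearB /= sK subrr.
have [|k kE] := @exists_linear V W (g \o s).
  move=> a x y /=.
  have -> : a *: x + y = h (a *: s x + s y) by rewrite linearP !sK.
  by rewrite gs linearP.
by exists k => x; rewrite kE /= gs.
Qed.

End LinearMaps.

(** * The canonical projection onto a quotient, and images and preimages of submodules *)

Section Quotients.
Context {R : pzRingType} {M : lmodType R} (S : submodClosed M).

Lemma pi_quot_linear : linear (\pi_(quot_mod S) : M -> quot_mod S).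
Proof. by move=> a x y; rewrite pi_quot_modD -pi_quot_scale. Qed.

Lemma pi_quot_eq0 x : (\pi_(quot_mod S) x = 0) <-> x \in S.
Proof.
rewrite -[X in X \in S]subr0 -eq_quot_mod.
have -> : \pi_(quot_mod S) 0 = 0 :> quot_mod S.
  by have [p pE] := exists_linear pi_quot_linear; rewrite -pE linear0.
by split=> /eqP.
Qed.

Lemma exists_pi_quot :
  exists p : {linear M -> quot_mod S},
    (forall y, exists x, p x = y) /\ (forall x, p x = 0 <-> x \in S).
Proof.
have [p pE] := exists_linear pi_quot_linear.
exists p; split=> [y|x]; last by rewrite pE; apply: pi_quot_eq0.
by exists (repr y); rewrite pE reprK.
Qed.

End Quotients.

Section ImagePreimage.
Context {R : pzRingType} {U V : lmodType R} (f : {linear U -> V}).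

Fact image_submod_closed (K : submodClosed U) :
  submod_closed (fun y : V => `[< exists2 x, x \in K & f x = y >]).
Proof.
split=> [|a y z /asboolP[u uK <-] /asboolP[v vK <-]]; apply/asboolP.
  by exists 0; rewrite ?linear0 ?rpred0.
by exists (a *: u + v); rewrite ?linearP //; apply: rpredD => //; apply: rpredZ.
Qed.
Definition image_submod K := mk_submod (image_submod_closed K).

Lemma in_image_submod K y :
  y \in image_submod K <-> exists2 x, x \in K & f x = y.
Proof. by split=> /asboolP. Qed.

Fact preim_submod_closed (Q : submodClosed V) :
  submod_closed (fun x : U => f x \in Q).
Proof.
split=> [|a x y fx fy]; rewrite unfold_in; first by rewrite linear0 rpred0.
by rewrite linearP; apply: (@rpredD _ Q) => //; apply: rpredZ.
Qed.
Definition preim_submod Q := mk_submod (preim_submod_closed Q).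

Lemma in_preim_submod Q x : (x \in preim_submod Q) = (f x \in Q).
Proof. by []. Qed.

End ImagePreimage.

(** * Correspondence and first isomorphism theorems *)

Section QuotientTheorems.
Context {R : pzRingType}.

(** Image under the projection is injective on submodules above [S], and preimage is injective on
    all submodules of the quotient. *)
Lemma finite_vertices_quot (M : lmodType R) (S : submodClosed M) :
  finite_set (vertices (quot_mod S)) <-> finite_set (above S).
Proof.
rewrite finite_vertices; have [p [p_surj p0]] := exists_pi_quot S.
split; first apply: (@finite_set_inj _ _ _ (image_submod p)) => //.
  suff sub K K' : above S K' -> image_submod p K = image_submod p K' ->
      {subset K <= K'}.
    by move=> K K' SK SK' eqKK'; apply: submod_eq; apply: sub.
  move=> SK' eqKK' x xK.
  have /in_image_submod[y yK' /eqP] : p x \in image_submod p K'.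
    by rewrite -eqKK'; apply/in_image_submod; exists x.
  rewrite eq_sym -subr_eq0 -linearB => /eqP/p0 /SK' xyK'.
  by rewrite -(subrK y x); apply: rpredD.
apply: (@finite_set_inj _ _ _ (preim_submod p)) => [Q _ x xS|Q Q' _ _ eqQ].
  by rewrite in_preim_submod (p0 x).2 // rpred0.
apply: submod_ext => y; have [x <-] := p_surj y.
by rewrite -!in_preim_submod eqQ.
Qed.

Lemma first_isomorphism (U V : lmodType R) (P : submodClosed U)
    (h : {linear U -> V}) :
  (forall y, exists x, h x = y) -> (forall x, h x = 0 <-> x \in P) ->
  isomorphic (quot_mod P) V.
Proof.
move=> h_surj h0; have [p [p_surj p0]] := exists_pi_quot P.
have [|f fE] := factor_linear (g := h) p_surj.
  by move=> x /p0 xP; apply/h0.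
exists f; have /choice[s sK] := h_surj; exists (p \o s) => [y|y] /=.
  have [x <-] := p_surj y; rewrite fE.
  apply/eqP; rewrite -subr_eq0 -linearB; apply/eqP/p0/h0.
  by rewrite linearB /= sK subrr.
by rewrite fE sK.
Qed.

End QuotientTheorems.

(** * Complements of [S] as graphs of maps [A -> S] *)

Section Graphs.
Context {R : pzRingType} {M : lmodType R} (A S : submodClosed M).
Implicit Types (g h : {linear submod_type A -> submod_type S}).

(** The pair [(a, g a)] is encoded as the sum [a + g a] in [M], which loses nothing once [S] and [A]
    meet in 0. *)
Fact graph_submod_closed g :
  submod_closed (fun x : M => `[< exists a, val a + val (g a) = x >]).
Proof.
split=> [|c x y /asboolP[a <-] /asboolP[b <-]]; apply/asboolP.
  by exists 0; rewrite !linear0 addr0.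
by exists (c *: a + b); rewrite !linearP scalerDr addrACA.
Qed.
Definition graph_submod g := mk_submod (graph_submod_closed g).

Lemma in_graph_submod g x :
  x \in graph_submod g <-> exists a, val a + val (g a) = x.
Proof. by split=> /asboolP. Qed.

Hypothesis SA0 : cap_submod S A = zero_submod M.

Lemma graph_submod_inj g h : graph_submod g = graph_submod h -> g =1 h.
Proof.
move=> eqgh a.
have /in_graph_submod[b eqab] : val a + val (g a) \in graph_submod h.
  by rewrite -eqgh; apply/in_graph_submod; exists a.
have dE : val b - val a = val (g a) - val (h b).
  by apply/eqP; rewrite subr_eq addrAC eq_sym subr_eq addrC eqab addrC.
have /eqP : val b - val a = 0.
  have /cap_submod0P := SA0; apply; last by rewrite -linearB; apply: valP.
  by rewrite dE -linearB; apply: valP.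
rewrite subr_eq0 => /eqP/val_inj eqba; move: dE.
by rewrite eqba subrr => /esym/eqP; rewrite subr_eq0 => /eqP/val_inj.
Qed.

(** For each [a] in [A] exactly one [s] in [S] puts [a + s] in [K]; uniqueness makes [a |-> s]
    linear, with kernel the part of [A] in [K]. *)
Lemma complement_graph K :
  cap_submod S K = zero_submod M -> sum_submod K S = sum_submod A S ->
  exists g, K = graph_submod g /\ (forall a, g a = 0 <-> val a \in K).
Proof.
move=> /cap_submod0P SK0 eqKA.
have uniqS (s t : submod_type S) : val s - val t \in K -> s = t.
  move=> stK; apply/val_inj/eqP; rewrite -subr_eq0; apply/eqP/SK0 => //.
  by rewrite -linearB; apply: valP.
have /choice[g gK] (a : submod_type A) :
    exists s : submod_type S, val a + val s \in K.
  have : val a \in sum_submod K S.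
    by rewrite eqKA; apply: sub_sum_submodl; apply: valP.
  move=> /in_sum_submod[k kK akS].
  (* Subtracting the [S]-component of [a] leaves its component [k] in [K]. *)
  exists (- (Sub (val a - k) akS : submod_type S)).
  by rewrite linearN /= opprB addrC subrK.
have [|f fE] := @exists_linear _ _ _ g.
  move=> c a b; apply: uniqS.
  have -> : val (g (c *: a + b)) - val (c *: g a + g b) =
    val (c *: a + b) + val (g (c *: a + b)) -
      (c *: (val a + val (g a)) + (val b + val (g b))).
    have valL (T : submodClosed M) (u v : submod_type T) :
      val (c *: u + v) = c *: val u + val v by exact: linearP.
    rewrite !valL scalerDr [in RHS](addrACA (c *: val a)) [in RHS]opprD.
    by rewrite [RHS]addrACA subrr add0r.
  by apply: submodB => //; apply: rpredD => //; apply: rpredZ.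
exists f; split.
  apply: submod_eq => x; last by move=> /in_graph_submod[a <-]; rewrite fE.
  move=> xK; have : x \in sum_submod A S by rewrite -eqKA sub_sum_submodl.
  move=> /in_sum_submod[a aA xaS]; apply/in_graph_submod.
  pose a' : submod_type A := Sub a aA; pose s : submod_type S := Sub (x - a) xaS.
  exists a'; rewrite fE; suff -> : g a' = s by rewrite !SubK addrC subrK.
  apply: uniqS; rewrite SubK.
  have -> : val (g a') - (x - a) = (val a' + val (g a')) - x.
    by rewrite SubK opprB addrCA addrA.
  exact: submodB.
move=> a; rewrite fE; split=> [ga0|aK].
  by have := gK a; rewrite ga0 linear0 addr0.
apply: uniqS; rewrite !linear0 addr0.
by rewrite -(addKr (val a) (val (g a))) addrC; apply: submodB.
Qed.

End Graphs.

(** * Complements of a simple submodule and its endomorphisms *)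

Section InfinitelyManyComplements.
Context {R : pzRingType} {M : lmodType R}.
Implicit Types N S T K A B : submodClosed M.

Lemma surjective_onto_simple (U : lmodType R) S
    (h : {linear U -> submod_type S}) :
  simple_submod S -> (exists x, h x <> 0) -> forall s, exists x, h x = s.
Proof.
(* The image is taken in [M], where simplicity of [S] applies. *)
move=> [_ minS] [x hx0] s; pose vh : {linear U -> M} := val \o h.
have [y /in_image_submod[z _ <-]|im0|imS] :=
    minS (image_submod vh (full_submod U)).
- exact: valP.
- have : vh x \in image_submod vh (full_submod U).
    by apply/in_image_submod; exists x.
  rewrite im0 in_zero_submod => /eqP hx.
  by case: hx0; apply: val_inj; rewrite linear0.
have : val s \in image_submod vh (full_submod U) by rewrite imS; apply: valP.
by move=> /in_image_submod[y _ /val_inj]; exists y.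
Qed.

(** Two pigeonhole steps isolate infinitely many graphs of maps [A -> S] with one kernel [B]. The
    conclusion [X A] later yields that [A] meets [N] in 0. *)
Lemma infinite_complements S (X : set (submodClosed M)) :
  simple_submod S -> finite_set (above S) -> infinite_set X ->
  (forall K, X K -> cap_submod S K = zero_submod M) ->
  infinite_set [set: End S] /\
  exists A B, [/\ X A, {subset B <= A} &
                  isomorphic (subquotient A B) (submod_type S)].
Proof.
move=> simS finS infX XS0.
have aboveS K : above S (sum_submod K S) by apply: sub_sum_submodr.
have [C infC] := infinite_fibre infX (fun K _ => aboveS K) finS.
have [A [XA AC]] := infinite_setN0 infC.
(* Discarding [A], the graph of the zero map, ensures that the map [h] below is nonzero, hence
   onto. *)
have infCA := infinite_setD infC (finite_set1 A).
have [D infD] :=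
  infinite_fibre infCA (fun K _ => aboveS (cap_submod A K)) finS.
set Y := (X in infinite_set X) in infD.
have SA0 := XS0 A XA.
(* The modular law recovers [cap_submod A K] from its sum [D] with [S], so it is the same for all
   [K] in [Y]. *)
have capE K : Y K -> cap_submod A K = cap_submod D A.
  move=> [_ <-]; rewrite sum_submod_modular // => x.
  by rewrite in_cap_submod => /andP[].
pose B := cap_submod D A.
have BA : {subset B <= A} by move=> x; rewrite in_cap_submod => /andP[].
have graphE K : Y K -> exists g : {linear submod_type A -> submod_type S},
    K = graph_submod g /\ (forall a, g a = 0 <-> val a \in B).
  move=> YK; have [[[XK KC] _] _] := YK.
  have [|g [Kg g0]] := @complement_graph _ _ A S K (XS0 K XK).
    by rewrite KC AC.
  exists g; split=> // a.
  rewrite g0 /B -(capE K YK) in_cap_submod.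
  by split=> [->|/andP[]]; rewrite ?andbT ?(valP a).
have [K1 YK1] := infinite_setN0 infD.
have [h [K1h h0]] := graphE K1 YK1.
have h_surj : forall s, exists a, h a = s.
  apply: surjective_onto_simple => //; apply: contrapT => /forallNP hN0.
  have {}hN0 a : h a = 0 by apply: contrapT; apply: hN0.
  have [[_ neqK1A] _] := YK1; apply: neqK1A; rewrite /= K1h.
  apply: submod_eq => x.
    by move=> /in_graph_submod[a <-]; rewrite hN0 linear0 addr0; apply: valP.
  move=> xA; apply/in_graph_submod; exists (Sub x xA).
  by rewrite hN0 linear0 addr0 SubK.
split; last first.
  exists A, B; split=> //.
  by apply: (first_isomorphism (h := h)) => // a; rewrite h0.
move=> finE; apply: infD.
pose G (k : End S) : submodClosed M :=
  graph_submod ((k : {linear submod_type S -> submod_type S}) \o h).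
(* Every [K] in [Y] is the graph of a map with the kernel of [h], hence of some [k \o h]; finitely
   many [k] would make [Y] finite. *)
apply: sub_finite_set (finite_image G finE) => K YK.
have [g [-> g0]] := graphE K YK.
have [|k kE] := factor_linear (g := g) h_surj.
  by move=> a /h0 aB; apply/g0.
by exists k => //; rewrite /G; congr graph_submod; apply: linear_ext.
Qed.

(** Composing with the surjection [A -> A/B -> S] turns distinct endomorphisms of [S] into distinct
    maps, hence distinct graphs. *)
Lemma infinite_graphs A B S :
  cap_submod S A = zero_submod M ->
  isomorphic (subquotient A B) (submod_type S) ->
  infinite_set [set: End S] -> infinite_set [set: submodClosed M].
Proof.
move=> SA0 [f [f' fK f'K]] infE finM; apply: infE.
have [p [p_surj _]] := exists_pi_quot (trace_submod A B).
pose G (k : End S) : submodClosed M :=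
  graph_submod ((k : {linear submod_type S -> submod_type S}) \o (f \o p)).
apply: (@finite_set_inj _ _ _ G) finM => // k l _ _ eqG.
apply: linear_ext => s.
have [a aE] := p_surj (f' s).
by have /= := graph_submod_inj SA0 eqG a; rewrite aE f'K.
Qed.

(** If [T] avoided [S], adding [S] would embed the submodules of [T] in the finite set [above S]. So
    [T] would contain a simple submodule, which by uniqueness is [S]. *)
Lemma unique_simple_essential N S T :
  unique_simple_in N S -> finite_set (above S) ->
  {subset T <= N} -> T <> zero_submod M -> {subset S <= T}.
Proof.
move=> [[simS SN] uniqS] finS TN nzT; apply: (simple_submod_sub simS) => ST0.
have finT : finite_set (below T).
  apply: (@finite_set_inj _ _ _ (sum_submod^~ S)) finS => [K _|K K' KT K'T eqKK'].
    exact: sub_sum_submodr.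
  by rewrite -(sum_submod_modular KT ST0) eqKK' sum_submod_modular.
have [S' [simS' S'T]] := exists_simple_below finT nzT.
have SS' : S = S' by apply: uniqS; split=> // x /S'T /TN.
case: simS => nzS _; apply: nzS; rewrite -ST0 SS'; apply: submod_ext => x.
rewrite in_cap_submod; case: (boolP (x \in S')) => //= /S'T ->.
by [].
Qed.

Lemma unique_simple_below N :
  nontrivial N -> infinite_set [set: submodClosed M] ->
  finite_set (meeting N) -> exists S, unique_simple_in N S.
Proof.
move=> [nzN _] infM finN.
have finbN : finite_set (below N).
  apply: (@sub_finite_set _ _ ([set zero_submod M] `|` meeting N)).
    move=> K KN; have [->|nzK] := pselect (K = zero_submod M); first by left.
    by right; apply: submod_sub_neq0 nzK => x xK; rewrite in_cap_submod KN.
  by rewrite finite_setU; split=> //; apply: finite_set1.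
have [S [simS SN]] := exists_simple_below finbN nzN.
exists S; split=> // S' [simS' S'N]; apply: contrapT => neqSS'.
have SS'0 : cap_submod S S' = zero_submod M.
  have [x|//|capE] := simS.2 (cap_submod S S').
    by rewrite in_cap_submod => /andP[].
  have [x xS|S0|//] := simS'.2 S; last by case: simS.
  by move: xS; rewrite -capE in_cap_submod => /andP[].
(* The contradiction is that only finitely many [K] meet [N] in 0: such a [K] is determined by its
   sums with [S] and [S'], both of which lie in [meeting N]. *)
apply: (infinite_setD infM finN).
have finNN := finite_setX finN finN.
pose F K := (sum_submod K S, sum_submod K S').
apply: (@finite_set_inj _ _ _ F) finNN => [K _|K K' [_ NK] [_ NK'] eqF].
  split; [apply: (above_sub_meeting SN simS.1)|
          apply: (above_sub_meeting S'N simS'.1)]; exact: sub_sum_submodr.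
suff sub K1 K2 : cap_submod N K2 = zero_submod M -> F K1 = F K2 ->
    {subset K1 <= K2}.
  by apply: submod_eq; apply: sub => //; apply: contrapT.
move=> /cap_submod0P NK0 eqF12 x xK1.
have eqS : sum_submod K1 S = sum_submod K2 S := congr1 fst eqF12.
have eqS' : sum_submod K1 S' = sum_submod K2 S' := congr1 snd eqF12.
have : x \in sum_submod K2 S by rewrite -eqS sub_sum_submodl.
have : x \in sum_submod K2 S' by rewrite -eqS' sub_sum_submodl.
move=> /in_sum_submod[y yK2 xyS'] /in_sum_submod[z zK2 xzS].
(* The difference [y - z] lies in [K2] and in [S + S'], hence in [N], so it vanishes. Then [x - z]
   lies in both [S] and [S'], which forces [x = z]. *)
suff eqyz : y = z.
  move/cap_submod0P: SS'0 => /(_ (x - z)); rewrite -{2}eqyz => /(_ xzS xyS').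
  by move=> /eqP; rewrite subr_eq0 => /eqP->.
apply/eqP; rewrite -subr_eq0; apply/eqP/NK0; last exact: submodB.
have -> : y - z = (x - z) - (x - y) by rewrite opprB [RHS]addrC addrA subrK.
by apply: submodB; [apply: SN|apply: S'N].
Qed.

End InfinitelyManyComplements.

Theorem theorem2p7 (R : pzRingType) (M : lmodType R) (N : submodClosed M)
    (Nnt : nontrivial N) :
  ((infinite_set (vertices M) /\ finite_set (neighbors N)) <->
   (exists S : submodClosed M,
     [/\ unique_simple_in N S,
         infinite_set [set: End S],
         finite_set (vertices (quot_mod S))
       & exists A B : submodClosed M,
           [/\ {subset B <= A},
               cap_submod N A = zero_submod M
             & isomorphic (subquotient A B) (submod_type S)]])) /\
  (forall S : submodClosed M, unique_simple_in N S ->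
     (finite_set (vertices (quot_mod S)) <-> finite_set (neighbors S))).
Proof.
split; last first.
  move=> S [[simS _] _].
  by rewrite finite_vertices_quot finite_neighborsE meeting_simple.
have capS (S K : submodClosed M) :
    {subset S <= N} -> cap_submod N K = zero_submod M ->
    cap_submod S K = zero_submod M.
  by move=> SN /cap_submod0P NK0; apply/cap_submod0P => x /SN; apply: NK0.
rewrite finite_vertices finite_neighborsE; split.
  move=> [infM finN]; have [S uS] := unique_simple_below Nnt infM finN.
  have [[simS SN] _] := uS.
  have finS := sub_finite_set (above_sub_meeting SN simS.1) finN.
  (* The set [X] consists of the submodules meeting [N] in 0, so they also meet [S] in 0. *)
  have infX := infinite_setD infM finN.
  have [|infE [A [B [[_ NA0] BA isoAB]]]] :=
    infinite_complements simS finS infX.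
    by move=> K [_ /contrapT NK0]; apply: capS.
  exists S; split=> //; first by apply/finite_vertices_quot.
  by exists A, B; split=> //; apply: contrapT.
move=> [S [uS infE /finite_vertices_quot finS [A [B [_ NA0 isoAB]]]]].
have [[simS SN] _] := uS.
split; first by apply: infinite_graphs isoAB infE; apply: capS.
(* Any [K] meeting [N] contains [S], since the nonzero submodule [cap_submod N K] of [N] does. *)
apply: (sub_finite_set _ finS) => K NK0 x xS.
have : x \in cap_submod N K.
  apply: (unique_simple_essential uS finS _ NK0 xS) => y.
  by rewrite in_cap_submod => /andP[].
by rewrite in_cap_submod => /andP[].
Qed.
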